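(* Let $G$ be a connected graph of order $n \geq 5$ (that is, with $n$ vertices). If $|E(G)| \geq \binom{n-3}{2} + 3$, then $rc(G) \leq 4$.
   Context: All graphs are finite and simple. An edge-colored graph $G$ (each edge is assigned a color; adjacent edges may receive the same color) is called rainbow connected if any two vertices of $G$ are connected by a path whose edges have pairwise distinct colors. The rainbow connection number $rc(G)$ of a connected graph $G$ is the smallest number of colors needed in an edge-coloring of $G$ that makes $G$ rainbow connected. $E(G)$ denotes the edge set of $G$. *)

(* Defs.v *)
From mathcomp Require Import all_boot boolp.

Set Implicit Arguments.
Unset Strict Implicit.
Unset Printing Implicit Defensive.

Record sgraph := SGraph {
  vertex :> finType;
  adj : rel vertex;
  adj_sym : symmetric adj;
  adj_irr : irreflexive adj
}.

Definition edges (G : sgraph) : {set {set G}} :=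
  [set [set x; y] | x in G, y in G & adj x y].

Definition connected (G : sgraph) : Prop :=
  forall x y : G, connect (@adj G) x y.

(* An edge-coloring is a map on all vertex sets; only its values on [edges G]
   are ever used. *)
Definition path_colors (G : sgraph) (c : {set G} -> nat) (x : G) (p : seq G) :
  seq nat := pairmap (fun u v => c [set u; v]) x p.

(* [x :: p] is a path (no repeated vertex) from [x] to [y]. *)
Definition rainbow_path (G : sgraph) (c : {set G} -> nat) (x y : G)
    (p : seq G) : Prop :=
  [/\ path (@adj G) x p, uniq (x :: p), last x p = y
    & uniq (path_colors c x p)].

Definition rainbow_connected (G : sgraph) (c : {set G} -> nat) : Prop :=
  forall x y : G, exists p, rainbow_path c x y p.

Definition rainbow_colorable (G : sgraph) (k : nat) : Prop :=
  exists c : {set G} -> nat,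
    {in edges G, forall A, c A < k} /\ rainbow_connected c.

(* Coloring the edges injectively shows that [rc] is well defined. *)
Lemma rainbow_colorable_ex (G : sgraph) :
  connected G -> exists k, `[< rainbow_colorable G k >].
Proof.
move=> conG; exists #|{set G}|; apply/asboolP.
exists (fun A => enum_rank A : nat); split=> [A _|x y]; first exact: ltn_ord.
have /connectP[q q_path ->] := conG x y.
case/shortenP: q_path => p p_path p_uniq _.
exists p; split=> //.
elim: p x p_path p_uniq => //= z p IHp x /andP[_ p_path] /andP[xNzp p_uniq].
rewrite {}IHp // andbT.
have: x \notin z :: p by [].
have : forall u s, x \notin u :: s ->
    (enum_rank [set x; z] : nat)
      \notin path_colors (fun A : {set G} => enum_rank A : nat) u s.
  move=> u s; elim: s u => //= v s IHs u.
  rewrite !inE !negb_or => /and3P[xNu xNv xNs].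
  rewrite IHs ?inE ?negb_or ?xNv // andbT.
  apply/eqP=> /val_inj/enum_rank_inj/setP/(_ x).
  by rewrite !inE eqxx (negbTE xNu) (negbTE xNv).
exact.
Qed.

Definition rc (G : sgraph) (conG : connected G) : nat :=
  ex_minn (rainbow_colorable_ex conG).

(* Main.v *)
Require Import Defs.
From mathcomp Require Import all_boot.
From mathcomp Require Import zify.

(** Write [n] for the number of vertices and count missing adjacencies instead
    of edges: for [k = 4] the hypothesis says that at most [3n - 9] pairs are
    non-adjacent.  Analogous bounds are [2n - 5] for three colors and [n - 2]
    for two colors, and the three statements are proved in this order
    ([rcol2], [rcol3_dense], [rcol4_dense]).  The missing degree of a vertex is
    the number of other vertices not adjacent to it, and [msum] is the sum of
    all missing degrees, so that the bounds read [2n - 4], [4n - 10] and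
    [6n - 18].

    Two colors.  If some [x] misses exactly one vertex [y], delete [x], color
    the rest, and color [x w] differently from [w y] for a common neighbor [w].
    Otherwise the vertices that miss something miss at least two, which forces
    the set [I] of vertices missing nothing to be large; then a proper coloring
    of the missing graph by subsets of [I] says how to color the edges that
    meet [I].

    [k] colors, for [k] equal to 3 or 4.  Three reductions and one explicit
    coloring suffice.

    - Contracting a clique costs one color ([rcol_contract]).  An edge in no
      triangle, or a triangle with two vertices of large missing degree, loses
      so many missing pairs when contracted that the statement for [k - 1]
      colors applies.  So every edge lies in a triangle and the missing degrees
      of adjacent vertices have a sum less than about [n]
      ([contractible_or_rigid]).

    - If a vertex [v] misses at most [k - 2] vertices, color around it
      ([rcol_star]): the neighbors of [v] are split into two classes so that
      each has a neighbor in the opposite class; the edges from [v] to the two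
      classes get two different colors, and the other colors serve the edges
      between neighbors of [v] and the edges to vertices that [v] misses.

    - Otherwise let [x] have the least missing degree [s >= k - 1].  Deleting
      [x] loses enough missing pairs for induction on [n].  To put [x] back
      ([rcol_add]), pick for each missed [y] a common neighbor of [x] and [y]
      so that no vertex is picked [k] times; each edge [x w] then has a color
      different from those of the at most [k - 1] edges [w y] it serves.
      Rigidity gives every vertex enough neighbors for these choices to exist
      ([spread_ex]) and, by counting missing pairs across a cut, for the rest to
      be connected.

    Deletion and contraction are expressed on a fixed vertex type, by shrinking
    a vertex set [U] and changing the adjacency relation [e]. *)

Set Implicit Arguments.
Unset Strict Implicit.
Unset Printing Implicit Defensive.

(** * Colored walks *)

Section Walks.

Variable T : finType.
Implicit Types (e : rel T) (c : T -> T -> nat) (U A K : {set T}).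

(** Only the vertices entered by a step are required to lie in [U], so that
    walks can be extended on the left and concatenated without side
    conditions. *)
Inductive walk e c U : T -> seq nat -> T -> Prop :=
| walk_nil u : walk e c U u [::] u
| walk_cons u v w s : e u v -> v \in U -> walk e c U v s w ->
    walk e c U u (c u v :: s) w.

Definition rainbow e c U u v := exists s, uniq s /\ walk e c U u s v.

(** The coloring is a total symmetric function of two vertices, and walks
    replace paths: by [walk_path] a rainbow walk contains a rainbow path. *)
Definition rcol k e U :=
  exists c, [/\ forall u v, c u v = c v u, forall u v, c u v < k
    & {in U &, forall u v, rainbow e c U u v}].

Lemma walk_cat e c U u v w s t :
  walk e c U u s v -> walk e c U v t w -> walk e c U u (s ++ t) w.
Proof.
elim=> //= {u v s} u v v' s euv vU _ IH /IH; exact: walk_cons.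
Qed.

Lemma walk1 e c U u v : e u v -> v \in U -> walk e c U u [:: c u v] v.
Proof. by move=> euv vU; apply: walk_cons => //; apply: walk_nil. Qed.

Lemma rainbow0 e c U u : rainbow e c U u u.
Proof. by exists [::]; split=> //; apply: walk_nil. Qed.

Lemma rainbow1 e c U u v : e u v -> v \in U -> rainbow e c U u v.
Proof. by move=> euv vU; exists [:: c u v]; split=> //; apply: walk1. Qed.

Lemma walk_rev e c U u v s : symmetric e -> (forall a b, c a b = c b a) ->
  u \in U -> walk e c U u s v -> walk e c U v (rev s) u.
Proof.
move=> es cs uU w; elim: w uU => {u v s} [u _|u v w s euv vU _ IH uU].
  exact: walk_nil.
rewrite rev_cons -cats1; apply: walk_cat (IH vU) _.
by rewrite cs; apply: walk1; rewrite // es.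
Qed.

Lemma rainbow_sym e c U u v : symmetric e -> (forall a b, c a b = c b a) ->
  u \in U -> rainbow e c U u v -> rainbow e c U v u.
Proof.
move=> es cs uU [s [us ws]]; exists (rev s); rewrite rev_uniq; split=> //.
exact: walk_rev.
Qed.

(** Cutting the loops out of a walk leaves a path whose colors form a
    subsequence of the colors of the walk. *)
Lemma walk_path e c U u v s : walk e c U u s v ->
  exists p, [/\ path e u p, uniq (u :: p), {subset p <= U}, last u p = v
    & subseq (pairmap c u p) s].
Proof.
elim=> {u v s} [u|u v w s euv vU _ [p [pp up pU lp sp]]]; first by exists [::].
have [uv|uv] := eqVneq u v.
  exists p; rewrite uv; split=> //.
  by apply: subseq_trans sp _; apply: subseq_cons.
have [up'|up'] := boolP (u \in p); last first.
  exists (v :: p); split=> //=.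
  - by rewrite euv.
  - by move: up => /= ->; rewrite inE negb_or uv up'.
  - by move=> z; rewrite inE => /predU1P[->//|/pU].
  - by rewrite eqxx.
case/splitPr: up' pp up pU lp sp => p1 p2.
rewrite cat_path last_cat pairmap_cat /= cat_uniq.
case/and3P=> _ _ pp /andP[_ /and3P[_ _ up]] pU lp sp.
exists p2; split=> //; first by move=> z zp; rewrite pU // mem_cat inE zp !orbT.
apply: subseq_trans (subseq_trans _ sp) (subseq_cons _ _).
apply: subseq_trans (suffix_subseq _ _).
exact: subseq_cons.
Qed.

(** * Adding a vertex *)

Definition miss e U u := [set w in U | (w != u) && ~~ e u w].

Definition fresh k (l : seq nat) := find (fun i => i \notin l) (iota 0 k).

Lemma freshP k l : size l < k -> (fresh k l < k) && (fresh k l \notin l).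
Proof.
move=> lk; have hl : has (fun i => i \notin l) (iota 0 k).
  apply: contraLR lk => /hasPn h; rewrite -leqNgt -{1}(size_iota 0 k).
  by apply: uniq_leq_size (iota_uniq _ _) _ => i /h; rewrite negbK.
have lt : fresh k l < k by rewrite -{2}(size_iota 0 k) -has_find.
rewrite lt /=; have := nth_find 0 hl; by rewrite nth_iota ?add0n.
Qed.

(** A vertex [w] serves the vertices [y] with [f y = w]: the edge [x w] must
    avoid the colors of the edges [w y], and one of [k] colors remains as long
    as [w] serves fewer than [k] vertices. *)
Lemma rcol_add k e U x (f : T -> T) : symmetric e -> x \in U ->
  {in miss e U x, forall y, [&& f y \in U, e x (f y) & e (f y) y]} ->
  irreflexive e ->
  (forall w, #|[set y in miss e U x | f y == w]| < k) ->
  rcol k e (U :\ x) -> rcol k e U.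
Proof.
move=> es xU fP ei fib [c [cs ck cr]].
pose l w := [seq c w y | y <- enum [set y in miss e U x | f y == w]].
pose g w := fresh k (l w).
have gP w : (g w < k) && (g w \notin l w).
  by apply: freshP; rewrite size_map -cardE.
pose c' u w := if u == x then g w else if w == x then g u else c u w.
have cs' u w : c' u w = c' w u.
  by rewrite /c'; case: eqP => ux; case: eqP => wx; rewrite ?ux ?wx.
have lift u s w : u != x -> walk e c (U :\ x) u s w -> walk e c' U u s w.
  move=> ux h; elim: h ux => {u s w} [u _|u v w s euv]; first exact: walk_nil.
  rewrite in_setD1 => /andP[vx vU] _ IH ux.
  have -> : c u v = c' u v by rewrite /c' (negbTE ux) (negbTE vx).
  by apply: walk_cons => //; apply: IH.
have fromx u : u \in U -> rainbow e c' U x u.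
  move=> uU; have [->|ux] := eqVneq u x; first exact: rainbow0.
  have [exu|exu] := boolP (e x u); first exact: rainbow1.
  have um : u \in miss e U x by rewrite inE uU ux.
  have /and3P[fU exf efu] := fP _ um.
  have fx : f u != x by apply: contraTneq exf => ->; rewrite ei.
  exists [:: c' x (f u); c' (f u) u]; split; last first.
    by apply: walk_cons => //; apply: walk1.
  rewrite /= inE andbT /c' eqxx (negbTE fx) (negbTE ux).
  have /andP[_] := gP (f u); apply: contraNneq => ->.
  by apply/mapP; exists u; rewrite // mem_enum inE um eqxx.
exists c'; split=> // [u w|u w uU wU].
  by rewrite /c'; do 2?[case: eqP => // _]; case/andP: (gP u); case/andP: (gP w).
have [->|ux] := eqVneq u x; first exact: fromx.
have [->|wx] := eqVneq w x.
  by apply: rainbow_sym => //; apply: fromx.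
have [||s [us ws]] := cr u w; rewrite ?inE ?ux ?wx //.
by exists s; split=> //; apply: lift.
Qed.

(** * Contracting a clique *)

(** The vertex [z] of [K] stands for the contracted set; the other vertices
    of [K] are meant to be dropped from the vertex set. *)
Definition contract e K z : rel T := fun u w =>
  if u == z then (w \notin K) && [exists a in K, e a w]
  else if w == z then (u \notin K) && [exists a in K, e a u] else e u w.

Definition clique e K := {in K &, forall a b, a != b -> e a b}.

Lemma contract_sym e K z : symmetric e -> z \in K -> symmetric (contract e K z).
Proof.
move=> es zK u w; rewrite /contract.
by case: eqP => uz; case: eqP => wz; rewrite ?uz ?wz ?zK // es.
Qed.

Lemma contract_irr e K z : irreflexive e -> z \in K ->
  irreflexive (contract e K z).
Proof.
by move=> ei zK u; rewrite /contract; case: eqP => [->|]; rewrite ?zK ?ei.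
Qed.

Lemma contractE e K z u w : z \in K -> u \notin K -> w \notin K ->
  contract e K z u w = e u w.
Proof.
move=> zK uK wK; rewrite /contract.
case: eqP => [uz|_]; first by rewrite uz zK in uK.
by case: eqP => [wz|//]; rewrite wz zK in wK.
Qed.

(** A rainbow path of the contracted graph visits [z] at most once, so it
    lifts to a walk that uses at most one edge inside [K]; all edges inside [K]
    can therefore share a single new color. *)
Lemma rcol_contract k e U K z : symmetric e -> K \subset U -> z \in K ->
  clique e K -> rcol k (contract e K z) (z |: (U :\: K)) -> rcol k.+1 e U.
Proof.
move=> es KU zK cK [c [cs ck cr]].
set e' := contract e K z in cr *; set U' := z |: (U :\: K) in cr *.
pose phi u := if u \in K then z else u.
pose c' u w := if (u \in K) && (w \in K) then k else c (phi u) (phi w).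
have phiU u : u \in U -> phi u \in U'.
  by move=> uU; rewrite /phi !inE; case: ifP => [|->]; rewrite ?eqxx ?uU ?orbT.
have memK u : u \in K -> u \in U by move/(subsetP KU).
have outU u : u \in U' -> u != z -> (u \notin K) * (u \in U).
  by rewrite !inE => /predU1P[->|/andP[-> ->]]; rewrite ?eqxx.
have inK a b : a \in K -> b \in K -> exists s,
    walk e c' U a s b /\ (s = [::] \/ s = [:: k]).
  move=> aK bK; have [->|ab] := eqVneq a b.
    by exists [::]; split; [apply: walk_nil|left].
  exists [:: k]; split; last by right.
  have -> : k = c' a b by rewrite /c' aK bK.
  by apply: walk1; [apply: cK|apply: memK].
(* Away from [z] a path is its own lift. *)
have avoid a p : path e' a p -> z \notin a :: p -> {subset a :: p <= U'} ->
    walk e c' U a (pairmap c a p) (last a p).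
  elim: p a => [|b p IH] a /=; first by move=> _ _ _; apply: walk_nil.
  case/andP=> eab pp; rewrite inE negb_or => /andP[za zp] sU.
  have az : a != z by rewrite eq_sym.
  have bz : b != z by move: zp; rewrite inE negb_or eq_sym => /andP[].
  have [aK aU] := outU a (sU _ (mem_head _ _)) az.
  have [|bK bU] := outU b _ bz; first by rewrite sU // !inE eqxx orbT.
  have -> : c a b = c' a b by rewrite /c' /phi (negbTE aK) (negbTE bK).
  apply: walk_cons => //; first by move: eab; rewrite /e' contractE.
  by apply: IH => // x xp; rewrite sU // inE xp orbT.
(* The endpoints [a0] and [b0] of the lift are prescribed in advance. *)
have lift p a a0 b0 : path e' a p -> uniq (a :: p) -> {subset a :: p <= U'} ->
    a0 \in U -> b0 \in U -> phi a0 = a -> phi b0 = last a p -> exists s,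
    walk e c' U a0 s b0 /\
    (perm_eq s (pairmap c a p) \/ perm_eq s (k :: pairmap c a p)).
  elim: p a a0 => [|b p IH] a a0 /=.
    move=> _ _ _ a0U b0U pa pb; have := etrans pa (esym pb).
    rewrite /phi; case: ifP => aK; case: ifP => bK.
    - have [s [ws hs]] := inK _ _ aK bK; exists s; split=> //.
      by case: hs => ->; [left|right].
    - by move=> zb; rewrite -zb zK in bK.
    - by move=> za; rewrite za zK in aK.
    - by move=> ->; exists [::]; split; [apply: walk_nil|left].
  case/andP=> eab pp /andP[abp ubp] sU a0U b0U pa pb.
  have sU' : {subset b :: p <= U'} by move=> x xp; rewrite sU // inE xp orbT.
  have [az|az] := eqVneq a z.
    have zbp : z \notin b :: p by rewrite -az.
    have bz : b != z by apply: contraNneq zbp => ->; rewrite mem_head.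
    have [bK bU] := outU b (sU' _ (mem_head _ _)) bz.
    have b0E : b0 = last b p.
      move: pb; rewrite /phi; case: ifP => // _ zl.
      by move: zbp; rewrite zl mem_last.
    have a0K : a0 \in K.
      apply: contraT => a0K; move: pa; rewrite /phi (negbTE a0K) az => a0z.
      by move: a0K; rewrite a0z zK.
    move: eab; rewrite /e' /contract az eqxx => /andP[_ /exists_inP[d dK edb]].
    have [s [ws hs]] := inK _ _ a0K dK.
    exists (s ++ c z b :: pairmap c b p); split.
      apply: walk_cat ws _.
      have -> : c z b = c' d b by rewrite /c' /phi dK (negbTE bK).
      apply: walk_cons => //; rewrite b0E; exact: avoid.
    by case: hs => -> /=; [left|right].
  have [aK aU] := outU a (sU _ (mem_head _ _)) az.
  have a0E : a0 = a.
    by move: pa; rewrite /phi; case: ifP => // _ h; rewrite h eqxx in az.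
  have [d [ead dU pd]] : exists d, [/\ e a d, d \in U & phi d = b].
    have [bz|bz] := eqVneq b z.
      move: eab; rewrite /e' /contract (negbTE az) bz eqxx.
      case/andP=> _ /exists_inP[d dK eda]; exists d; rewrite es /phi dK.
      by split=> //; apply: memK.
    have [bK bU] := outU b (sU' _ (mem_head _ _)) bz.
    by exists b; move: eab; rewrite /e' contractE // /phi (negbTE bK).
  have [s [ws hs]] := IH b d pp ubp sU' dU b0U pd pb.
  exists (c a b :: s); split.
    have -> : c a b = c' a0 d.
      by rewrite /c' a0E (negbTE aK) /= pd /phi (negbTE aK).
    by rewrite a0E; apply: walk_cons.
  case: hs => hs; [left|right]; first by rewrite perm_cons.
  have swap := permEl (perm_catCA [:: c a b] [:: k] (pairmap c b p)).
  by apply: perm_trans swap; rewrite /= perm_cons.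
have ck' u w : c' u w < k.+1.
  by rewrite /c'; case: ifP => // _; apply: ltnW; apply: ck.
exists c'; split=> // [u w|u w uU wU]; first by rewrite /c' andbC cs.
have [s [us ws]] := cr _ _ (phiU _ uU) (phiU _ wU).
have [p [pp up pU lp sp]] := walk_path ws.
have ump : uniq (pairmap c (phi u) p) by apply: subseq_uniq sp us.
have sU : {subset phi u :: p <= U'}.
  by move=> x; rewrite inE => /predU1P[->|/pU//]; apply: phiU.
have [t [wt ht]] := lift p _ u w pp up sU uU wU erefl (esym lp).
exists t; split=> //; case: ht => /perm_uniq -> //=.
rewrite ump andbT; move: (phi u); elim: p {pp up pU lp sp ump sU wt} => //= b p IH a.
by rewrite inE negb_or IH andbT neq_ltn ck orbT.
Qed.

(** * Coloring around a vertex of small missing degree *)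

Definition nbr e U v := [set u in U | e v u].

(** The neighbors of [v] are split into two classes by [col], and the edges
    from [v] to these classes have the colors 1 and 2; [io] is the color of
    the edges between neighbors of [v], and [sg x] that of the edges from a
    vertex [x] missed by [v] to the neighbors of [v].  Two neighbors of [v] in
    one class are joined by stepping first to the opposite class and then
    passing through [v].  A vertex [x] enters the neighborhood of [v] by an edge
    colored [sg x] and passes through [v] to the opposite class; to reach the
    class of its entry point it either has a second entry in the other class,
    or goes one step further along an edge colored [io]. *)
Lemma rcol_star k e U v (col : T -> bool) (sg : T -> nat) io :
  symmetric e -> irreflexive e -> v \in U -> 2 < k -> io < k ->
  (forall x, sg x < k) -> io \notin [:: 1; 2] ->
  (forall x, sg x \notin [:: 1; 2]) ->
  {in nbr e U v, forall u, exists w, [/\ w \in nbr e U v, e u w & col u != col w]} ->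
  {in miss e U v, forall x, exists a, [/\ a \in nbr e U v, e x a &
    sg x != io \/ exists b, [/\ b \in nbr e U v, e x b & col a != col b]]} ->
  {in miss e U v &, forall x y, x != y -> e x y \/ sg x != sg y /\
     exists a b, [/\ a \in nbr e U v, b \in nbr e U v, e x a, e y b & col a != col b]} ->
  rcol k e U.
Proof.
move=> es ei vU k2 iok sgk io12 sg12 hN hS hSS.
set N := nbr e U v in hN hS hSS *; set S := miss e U v in hS hSS *.
pose vc u := if col u then 1 else 2.
pose c u w := if u == v then vc w else if w == v then vc u else
  if u \in S then (if w \in S then io else sg u)
  else if w \in S then sg w else io.
have cs u w : c u w = c w u.
  rewrite /c; case: eqP => uv; case: eqP => wv; rewrite ?uv ?wv //.
  by do 2!case: ifP.
have Nfact u : u \in N -> [/\ u \in U, e v u, u != v & u \notin S].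
  rewrite inE => /andP[uU evu]; rewrite inE evu andbF uU; split=> //.
  by apply: contraTneq evu => ->; rewrite ei.
have Sfact u : u \in S -> [/\ u \in U & u != v].
  by rewrite inE => /and3P[-> -> _].
have cvN u : u \in N -> c v u = vc u by rewrite /c eqxx.
have cNv u : u \in N -> c u v = vc u by rewrite cs; apply: cvN.
have cNN u w : u \in N -> w \in N -> c u w = io.
  case/Nfact=> _ _ uv uS /Nfact[_ _ wv wS].
  by rewrite /c (negbTE uv) (negbTE wv) (negbTE uS) (negbTE wS).
have cSN u w : u \in S -> w \in N -> c u w = sg u.
  move=> uS; have [_ uv] := Sfact u uS.
  case/Nfact=> _ _ wv wS.
  by rewrite /c (negbTE uv) (negbTE wv) uS (negbTE wS).
have NU u : u \in N -> u \in U by case/Nfact.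
have evN u : u \in N -> e v u by case/Nfact.
have eNv u : u \in N -> e u v by rewrite es; case/Nfact.
have vcD a b : col a != col b -> vc a != vc b by rewrite /vc; case: (col a); case: (col b).
have sgvc a x : sg x != vc a.
  by have := sg12 x; rewrite !inE /vc negb_or => /andP[]; case: (col a).
have iovc a : io != vc a.
  by move: io12; rewrite !inE /vc negb_or => /andP[]; case: (col a).
have vcsg a x : vc a != sg x by rewrite eq_sym.
have vcio a : vc a != io by rewrite eq_sym.
have NN p q : p \in N -> q \in N -> col p != col q -> rainbow e c U p q.
  move=> pN qN pq; exists [:: vc p; vc q]; split.
    by rewrite /= inE vcD.
  rewrite -(cNv p pN) -(cvN q qN).
  by apply: walk_cons (walk1 _ _ _) => //; [apply: eNv|apply: evN|apply: NU].
have SN1 x a p : x \in S -> a \in N -> e x a -> p \in N -> col a != col p ->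
    rainbow e c U x p.
  move=> xS aN xa pN ap; exists [:: sg x; vc a; vc p]; split.
    by rewrite /= !inE !negb_or !sgvc vcD.
  rewrite -(cSN x a) // -(cNv a) // -(cvN p) //.
  apply: walk_cons (walk_cons _ _ (walk1 _ _ _)) => //;
    by [apply: NU|apply: eNv|apply: evN].
have SN x p : x \in S -> p \in N -> rainbow e c U x p.
  move=> xS pN; have [a [aN xa h]] := hS x xS.
  have [ap|ap] := eqVneq (col a) (col p); last exact: SN1 ap.
  case: h => [sgio|[b [bN xb ab]]]; last by apply: (@SN1 x b); rewrite // -ap eq_sym.
  have [q [qN pq cpq]] := hN p pN.
  exists [:: sg x; vc a; vc q; io]; split.
    by rewrite /= !inE !negb_or !sgvc !vcio sgio vcD // ap.
  rewrite -(cSN x a) // -(cNv a) // -(cvN q) // -(cNN q p) //.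
  apply: walk_cons (walk_cons _ _ (walk_cons _ _ (walk1 _ _ _))) => //;
    by [apply: NU|apply: eNv|apply: evN|rewrite es].
have SS x y : x \in S -> y \in S -> rainbow e c U x y.
  move=> xS yS; have [->|xy] := eqVneq x y; first exact: rainbow0.
  have [yU yv] := Sfact y yS.
  case: (hSS x y xS yS xy) => [exy|[sxy [a [b [aN bN xa yb ab]]]]].
    exact: rainbow1.
  exists [:: sg x; vc a; vc b; sg y]; split.
    by rewrite /= !inE !negb_or !sgvc !vcsg sxy vcD.
  rewrite -(cSN x a) // -(cNv a) // -(cvN b) // -(cSN y b) // (cs y b).
  apply: walk_cons (walk_cons _ _ (walk_cons _ _ (walk1 _ _ _))) => //;
    by [apply: NU|apply: eNv|apply: evN|rewrite es].
have NN' p q : p \in N -> q \in N -> rainbow e c U p q.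
  move=> pN qN; have [cpq|cpq] := eqVneq (col p) (col q); last exact: NN.
  have [r [rN pr cpr]] := hN p pN.
  exists [:: io; vc r; vc q]; split.
    by rewrite /= !inE !negb_or !iovc vcD // -cpq eq_sym.
  rewrite -(cNN p r) // -(cNv r) // -(cvN q) //.
  apply: walk_cons (walk_cons _ _ (walk1 _ _ _)) => //;
    by [apply: NU|apply: eNv|apply: evN].
have Sv x : x \in S -> rainbow e c U x v.
  move=> xS; have [a [aN xa _]] := hS x xS.
  exists [:: sg x; vc a]; split; first by rewrite /= inE sgvc.
  rewrite -(cSN x a) // -(cNv a) //.
  by apply: walk_cons (walk1 _ _ _) => //; [apply: NU|apply: eNv].
have vX w : w \in U -> rainbow e c U v w.
  move=> wU; have [->|wv] := eqVneq w v; first exact: rainbow0.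
  have [evw|evw] := boolP (e v w); first exact: rainbow1.
  have wS : w \in S by rewrite inE wU wv.
  by apply: rainbow_sym => //; apply: Sv.
exists c; split=> // [u w|u w uU wU].
  have vck a : vc a < k by rewrite /vc; case: (col a) => //; apply: ltnW.
  by rewrite /c; do 4?[case: ifP => // _].
have [->|uv] := eqVneq u v; first exact: vX.
have [->|wv] := eqVneq w v; first by apply: rainbow_sym => //; apply: vX.
have uSN : (u \in S) || (u \in N) by rewrite !inE uU uv /=; case: (e v u).
have wSN : (w \in S) || (w \in N) by rewrite !inE wU wv /=; case: (e v w).
case/orP: uSN => uX; case/orP: wSN => wX; [exact: SS|exact: SN| |exact: NN'].
by apply: rainbow_sym => //; apply: SN.
Qed.

(** * Counting missing edges *)

(** Every missing pair is counted twice, once from each end. *)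
Definition msum e U := \sum_(u in U) #|miss e U u|.

Lemma mem_miss e U u w : (w \in miss e U u) = [&& w \in U, w != u & ~~ e u w].
Proof. by rewrite inE. Qed.

Lemma miss_sym e U u w : symmetric e -> u \in U -> w \in miss e U u ->
  u \in miss e U w.
Proof. by move=> es uU; rewrite !mem_miss uU eq_sym es => /and3P[_ -> ->]. Qed.

Lemma missD1 e U x u : miss e (U :\ x) u = miss e U u :\ x.
Proof. by apply/setP=> w; rewrite !inE -!andbA. Qed.

Lemma miss_adj e U u w : e u w -> w \notin miss e U u.
Proof. by rewrite mem_miss => ->; rewrite !andbF. Qed.

Lemma missD1_adj e U x u : e u x -> miss e (U :\ x) u = miss e U u.
Proof.
move=> eux; rewrite missD1; apply/setP=> w; rewrite in_setD1.
by case: eqP => //= ->; rewrite (negbTE (miss_adj _ eux)).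
Qed.

Lemma msumD1 e U x : symmetric e -> x \in U ->
  msum e U = msum e (U :\ x) + 2 * #|miss e U x|.
Proof.
move=> es xU; rewrite /msum (big_setD1 x) //= mul2n -addnn addnA [LHS]addnC.
congr (_ + _); under eq_bigr => u _ do rewrite (cardsD1 x) -missD1 addnC.
rewrite big_split /=; congr (_ + _).
rewrite -sum1_card big_mkcond [RHS]big_mkcond /=; apply: eq_bigr => u _.
rewrite !mem_miss in_setD1 xU eq_sym es.
by case: (u \in U); case: eqP => //=; case: e.
Qed.

Lemma leq_sum_miss e U (A : {set T}) d : A \subset U ->
  {in A, forall u, d <= #|miss e U u|} -> d * #|A| <= \sum_(u in A) #|miss e U u|.
Proof.
move=> AU h; rewrite mulnC -sum_nat_const.
by apply: leq_sum => u; apply: h.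
Qed.

Lemma card_nbr_miss e U v : irreflexive e -> v \in U ->
  #|nbr e U v| + #|miss e U v| + 1 = #|U|.
Proof.
move=> ei vU; rewrite (cardsD1 v U) vU addnC; congr (_ + _).
rewrite -cardsUI -[RHS]addn0; congr (_ + _).
  apply: eq_card => w; rewrite !inE; case: (w \in U); rewrite ?andbF //=.
  by case: eqP => [->|_]; rewrite ?ei //=; case: (e v w).
by apply/eqP; rewrite cards_eq0; apply/eqP/setP=> w; rewrite !inE;
  case: (e v w); rewrite ?andbF.
Qed.

(** * Two colors *)

(** Vertices are colored one after the other, each with a color of [P] that
    differs from those of its at most [#|P| - 1] colored neighbors. *)
Lemma greedy (C : finType) (c0 : C) (h : rel T) (P : {set C}) (D : {set T}) :
  symmetric h -> irreflexive h ->
  {in D, forall u, #|[set w in D | h u w]| < #|P|} ->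
  exists g : T -> C, {in D, forall u, g u \in P} /\
    {in D &, forall u w, h u w -> g u != g w}.
Proof.
move=> hs hi hP.
suff gs (s : seq T) : {subset s <= D} -> exists g : T -> C,
    {in s, forall u, g u \in P} /\ {in s &, forall u w, h u w -> g u != g w}.
  have [|g [g1 g2]] := gs (enum D); first by move=> u; rewrite mem_enum.
  by exists g; split=> [u uD|u w uD wD]; [apply: g1|apply: g2];
    rewrite mem_enum.
elim: s => [_|x s IH sD]; first by exists (fun=> c0).
have [|g [g1 g2]] := IH; first by move=> u us; rewrite sD // inE us orbT.
have xD : x \in D by rewrite sD ?mem_head.
have [p pP pN] : exists2 p, p \in P & p \notin [set g w | w in [set w in D | h x w]].
  apply/subsetPn; apply: contraTN (hP x xD) => /subset_leq_card le.
  by rewrite -leqNgt (leq_trans le) // leq_imset_card.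
have pg w : w \in s -> h x w -> p != g w.
  move=> ws hxw; apply: contraNneq pN => ->; apply/imsetP; exists w => //.
  by rewrite inE hxw sD // inE ws orbT.
exists (fun u => if u == x then p else g u); split=> [u|u w].
  by rewrite inE; case: eqP => //= _; apply: g1.
rewrite !inE; case: eqP => [->|_] /= us; case: eqP => [->|_] //= ws huw.
- by rewrite hi in huw.
- exact: pg.
- by rewrite eq_sym; apply: pg; rewrite // hs.
- exact: g2.
Qed.

Lemma leq_double_exp i : 0 < i -> 2 * i <= 2 ^ i.
Proof.
by case: i => // i _; rewrite expnS leq_pmul2l //; apply: ltn_expl.
Qed.

(** Let [I] consist of the vertices adjacent to all others.  A proper coloring
    [g] of the missing graph outside [I] with subsets of [I] exists, since
    [2 ^ #|I|] exceeds the missing degrees.  When [u w] is missing, some [i] in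
    [I] belongs to exactly one of [g u] and [g w], so coloring each edge [u i]
    by membership of [i] in [g u] makes [u i w] rainbow. *)
Lemma rcol2_universal e U : symmetric e -> irreflexive e ->
  {in U, forall u, #|miss e U u| + 2 <= 2 * #|[set w in U | miss e U w == set0]|
     \/ miss e U u == set0} -> rcol 2 e U.
Proof.
move=> es ei hm; set I := [set w in U | _] in hm.
pose h u w := (w != u) && ~~ e u w.
have hs : symmetric h by move=> u w; rewrite /h eq_sym es.
have hi : irreflexive h by move=> u; rewrite /h eqxx.
have [|g [gI gh]] := @greedy {set T} set0 h (powerset I) (U :\: I) hs hi.
  move=> u; rewrite !inE => /andP[uI uU]; move: uI; rewrite uU /= => mu.
  case: (hm u uU) => [le|]; last by rewrite (negbTE mu).
  rewrite card_powerset; have i0 : 0 < #|I| by lia.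
  apply: leq_trans (leq_double_exp i0).
  suff : #|[set w in U :\: I | h u w]| <= #|miss e U u| by lia.
  apply: subset_leq_card; apply/subsetP=> w.
  by rewrite inE mem_miss in_setD => /andP[/andP[_ ->]].
pose c u w : nat := if u \in I then (if w \in I then 0 else nat_of_bool (u \in g w))
                    else if w \in I then nat_of_bool (w \in g u) else 0.
have eI i u : i \in I -> u \in U -> u \notin I -> e u i.
  rewrite inE => /andP[iU /eqP mi] uU uI; have := in_set0 u.
  rewrite -mi mem_miss uU /= => /negbT; rewrite negb_and !negbK es.
  by case/orP=> // /eqP ui; move: uI; rewrite ui inE iU mi eqxx.
exists c; split=> [u w|u w|u w uU wU]; rewrite /c.
- by case: ifP; case: ifP.
- by case: ifP => _; case: ifP => _ //; apply: (leq_ltn_trans (leq_b1 _)).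
have [->|uw] := eqVneq u w; first exact: rainbow0.
have [euw|euw] := boolP (e u w); first exact: rainbow1.
have huw : h u w by rewrite /h eq_sym uw.
have notI a b : a \in U -> b \in U -> h a b -> a \notin I.
  move=> aU bU hab; rewrite inE aU /=; apply/set0Pn; exists b.
  by rewrite mem_miss bU.
have uI := notI _ _ uU wU huw.
have wI : w \notin I by apply: (notI w u) => //; rewrite hs.
have [uD wD] : u \in U :\: I /\ w \in U :\: I by rewrite !in_setD uI wI.
have /existsP[i gi] : [exists i, (i \in g u) != (i \in g w)].
  apply: contraNT (gh u w uD wD huw); rewrite negb_exists => /forallP gE.
  by apply/eqP/setP=> i; apply/eqP; have := gE i; rewrite negbK.
have iI : i \in I.
  have [] := (gI u uD, gI w wD); rewrite !powersetE => /subsetP gu /subsetP gw.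
  by apply: contraNT gi => iI; rewrite (contraNF (gu i)) ?(contraNF (gw i)).
have iU : i \in U by move: iI; rewrite inE => /andP[].
exists [:: c u i; c i w]; split; last first.
  apply: walk_cons (eI _ _ iI uU uI) iU _; apply: walk1 => //.
  by rewrite es; apply: eI.
by rewrite /c iI (negbTE uI) (negbTE wI) /= inE andbT; move: gi; do 2!case: (_ \in _).
Qed.

(** Either a vertex missing exactly one other can be deleted, or all missing
    degrees differ from one; in the latter case the bound on [msum] leaves any
    single missing degree at most [2 * #|I| - 2], where [I] is the set of
    vertices missing nothing. *)
Lemma rcol2 e U : symmetric e -> irreflexive e ->
  msum e U + 4 <= 2 * #|U| -> rcol 2 e U.
Proof.
move=> es ei; have [m] := ubnP #|U|; elim: m U => // m IH U Um hM.
have [/exists_inP[x xU /cards1P[y my]]|no1] :=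
  boolP [exists x in U, #|miss e U x| == 1].
  have ym : y \in miss e U x by rewrite my set11.
  have yU : y \in U by move: ym; rewrite mem_miss => /andP[].
  have yx : y != x by move: ym; rewrite mem_miss => /and3P[].
  have U1 : #|U| = (#|U :\ x|).+1 by rewrite (cardsD1 x) xU.
  have rx : rcol 2 e (U :\ x).
    apply: IH; first by rewrite -ltnS -U1.
    by move: hM; rewrite (msumD1 es xU) my cards1; lia.
  have [w [wU exw ewy]] : exists w, [/\ w \in U, e x w & e w y].
    have [/exists_inP[w wU /andP[exw ewy]]|no] :=
      boolP [exists w in U, e x w && e w y]; first by exists w.
    (* Without a common neighbor of [x] and [y] everyone misses [y]. *)
    have my' w : w \in U -> w != y -> y \in miss e U w.
      move=> wU wy; have [->//|wx] := eqVneq w x.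
      rewrite mem_miss yU eq_sym wy /=.
      have: w \notin miss e U x by rewrite my inE.
      rewrite mem_miss wU wx /= negbK => exw.
      by move/exists_inPn: no => /(_ w wU); rewrite exw.
    have le1 : 1 * #|U :\ y| <= \sum_(u in U :\ y) #|miss e U u|.
      apply: leq_sum_miss (subD1set _ _) _ => u; rewrite in_setD1 => /andP[uy uU].
      by apply/card_gt0P; exists y; apply: my'.
    have le2 : #|U :\ y| <= #|miss e U y|.
      apply: subset_leq_card; apply/subsetP=> u; rewrite in_setD1 => /andP[uy uU].
      by apply: miss_sym => //; apply: my'.
    have Uy : #|U| = (#|U :\ y|).+1 by rewrite (cardsD1 y) yU.
    by move: hM; rewrite /msum (big_setD1 y) //=; lia.
  apply: (@rcol_add 2 e U x (fun=> w)) => //.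
    by move=> z; rewrite my inE => /eqP->; rewrite wU exw.
  move=> z; apply: (@leq_ltn_trans #|miss e U x|); last by rewrite my cards1.
  by apply: subset_leq_card; apply/subsetP=> a; rewrite inE => /andP[].
apply: rcol2_universal => // u uU; set I := [set w in U | _].
have [|mu] := boolP (miss e U u == set0); [by right|left].
have IU : I \subset U by apply/subsetP=> w; rewrite inE => /andP[].
have uD : u \in U :\: I by rewrite !inE uU (negbTE mu).
have le2 : 2 * #|(U :\: I) :\ u| <= \sum_(w in (U :\: I) :\ u) #|miss e U w|.
  apply: (@leq_sum_miss e U).
    by apply: subset_trans (subD1set _ _) (subsetDl _ _).
  move=> w; rewrite !inE negb_and => /and3P[_ hw wU]; move: hw; rewrite wU /=.
  rewrite -cards_eq0; have := exists_inPn no1 w wU.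
  by case: #|_| => [|[|]].
have cD : #|U :\: I| = (#|(U :\: I) :\ u|).+1 by rewrite (cardsD1 u) uD.
have cI : #|U| = #|I| + #|U :\: I|.
  by rewrite -(cardsID I U) (setIidPr IU).
have : \sum_(w in U :\: I) #|miss e U w| <= msum e U.
  rewrite /msum [leqRHS](big_setID I) /=; exact: leq_addl.
rewrite (big_setD1 u) //=; lia.
Qed.

(** * Contracting edges and triangles in dense graphs *)

(** Connectedness of the graph induced on [U], in the form used for counting:
    an edge leaves every proper nonempty part. *)
Definition linked e U := forall A, A \subset U -> A != set0 -> A != U ->
  exists u v, [/\ u \in A, v \in U :\: A & e u v].

Lemma linked_contract e U K z : symmetric e -> linked e U -> K \subset U ->
  z \in K -> linked (contract e K z) (z |: (U :\: K)).
Proof.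
move=> es lU KU zK A AU A0 AN.
pose phi u := if u \in K then z else u.
pose B := [set u in U | phi u \in A].
have phiE u : u \in z |: (U :\: K) -> (u \in U) && (phi u == u).
  rewrite !inE /phi => /predU1P[->|/andP[/negbTE-> ->]]; last by rewrite eqxx.
  by rewrite zK (subsetP KU) ?eqxx.
have [|||u [v [uB vB euv]]] := lU B.
- by apply/subsetP=> u; rewrite inE => /andP[].
- have /set0Pn[a aA] := A0; apply/set0Pn; exists a.
  have /andP[aU /eqP pa] := phiE a (subsetP AU _ aA).
  by rewrite inE aU pa.
- apply: contraNneq AN => BU; rewrite eqEsubset AU; apply/subsetP=> a aU'.
  have /andP[aU /eqP pa] := phiE a aU'.
  by move: aU; rewrite -BU inE pa => /andP[].
move: uB vB; rewrite !inE => /andP[uU uA] /andP[vA vU].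
have {}vA : phi v \notin A by move: vA; rewrite vU.
exists (phi u), (phi v); split=> //.
  by rewrite !inE vA /= /phi; case: ifP => [_|->]; rewrite ?eqxx ?vU ?orbT.
move: uA vA; rewrite /phi.
case: ifP => uK; case: ifP => vK uA vA; first by rewrite uA in vA.
- rewrite /contract eqxx vK /=; apply/exists_inP; by exists u.
- rewrite contract_sym // /contract eqxx uK /=.
  by apply/exists_inP; exists v; rewrite // es.
- by rewrite contractE ?uK ?vK.
Qed.

Lemma msum_contract e U K z : symmetric e -> z \in K ->
  msum (contract e K z) (z |: (U :\: K)) =
  msum e (U :\: K) + 2 * #|[set u in U :\: K | [forall a in K, ~~ e a u]]|.
Proof.
move=> es zK; have zO : z \notin U :\: K by rewrite inE zK.
rewrite (@msumD1 _ _ z) ?setU11 //; last exact: contract_sym.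
rewrite setU1K //; congr (_ + 2 * _).
  apply: eq_bigr => u; rewrite in_setD => /andP[uK uU]; apply: eq_card => w.
  rewrite !mem_miss in_setD; case: (boolP (w \in K)) => //= wK.
  by rewrite contractE.
apply: eq_card => u; rewrite mem_miss in_setU1 [in RHS]inE in_setD.
have [->|uz] := eqVneq u z; first by rewrite zK !andbF.
rewrite /contract eqxx /=; case: (boolP (u \in K)) => //= uK.
by rewrite negb_exists; congr (_ && _); apply: eq_forallb => a; rewrite negb_and implybE.
Qed.

(** What the induction uses of the graph [(e', U')] obtained from [(e, U)] by
    contracting a clique. *)
Definition contraction e U e' U' :=
  [/\ symmetric e', irreflexive e', linked e' U' &
     forall k, rcol k e' U' -> rcol k.+1 e U].

Lemma contraction_clique e U K z : symmetric e -> irreflexive e ->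
  linked e U -> K \subset U -> z \in K -> clique e K ->
  contraction e U (contract e K z) (z |: (U :\: K)).
Proof.
move=> es ei lU KU zK cK; split.
- exact: contract_sym.
- exact: contract_irr.
- exact: linked_contract.
- by move=> k; apply: rcol_contract.
Qed.

(** Every vertex outside the edge misses one of its ends, and contraction
    merges the pairs of a vertex missing both: exactly one missing pair
    disappears for each of the [#|U| - 2] other vertices. *)
Lemma contract_edge e U y z : symmetric e -> irreflexive e -> linked e U ->
  y \in U -> z \in U -> e y z -> {in U, forall t, ~~ (e y t && e z t)} ->
  exists e' U', [/\ contraction e U e' U', #|U| = #|U'|.+1 &
    msum e' U' + 2 * (#|U| - 2) <= msum e U].
Proof.
move=> es ei lU yU zU eyz no.
have yz : y != z by apply: contraTneq eyz => ->; rewrite ei.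
pose K := [set y; z].
have yK : y \in K by rewrite !inE eqxx.
have KU : K \subset U by rewrite subUset !sub1set yU.
have cK : clique e K.
  by move=> a b; rewrite !inE => /orP[]/eqP-> /orP[]/eqP->; rewrite ?eqxx // es.
exists (contract e K y), (y |: (U :\: K)).
have cO : #|U :\: K| + 2 = #|U|.
  have := subset_leq_card KU.
  by rewrite cardsD (setIidPr KU) cards2 yz; lia.
split; first exact: contraction_clique.
  by rewrite cardsU1 inE yK /=; lia.
rewrite msum_contract // (msumD1 es yU) (@msumD1 _ (U :\ y) z) //; last first.
  by rewrite in_setD1 eq_sym yz.
have -> : U :\ y :\ z = U :\: K.
  by apply/setP=> t; rewrite !inE negb_or andbA [in LHS](andbC (t != z)).
rewrite missD1_adj; last by rewrite es.
set X := [set u in _ | _].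
have XE : X = miss e U y :&: miss e U z.
  apply/setP=> t; rewrite !inE negb_or.
  have -> : [forall a in K, ~~ e a t] = ~~ e y t && ~~ e z t.
    apply/forall_inP/andP=> [h|[hy hz] a].
      by split; apply: h; rewrite !inE eqxx ?orbT.
    by rewrite !inE => /orP[]/eqP->.
  by case: (t \in U); case: (t == y); case: (t == z); case: (e y t); case: (e z t).
have OE : U :\: K = miss e U y :|: miss e U z.
  apply/setP=> t; rewrite !inE negb_or.
  case: (boolP (t \in U)) => [tU|]; last by rewrite !andbF.
  have := no t tU; case: (eqVneq t y) => [->|ty].
    by rewrite (es z y) eyz /= !andbF.
  case: (eqVneq t z) => [->|tz]; first by rewrite eyz /= ?andbF.
  by case: (e y t); case: (e z t).
have := cardsUI (miss e U y) (miss e U z); rewrite -XE -OE; lia.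
Qed.

(** After contraction the merged vertex misses at most the vertices missed by
    [z], so the missing pairs at [x] and at [y] disappear. *)
Lemma contract_triangle e U x y z : symmetric e -> irreflexive e ->
  linked e U -> x \in U -> y \in U -> z \in U -> e x y -> e x z -> e y z ->
  exists e' U', [/\ contraction e U e' U', #|U| = #|U'|.+2 &
    msum e' U' + 2 * (#|miss e U x| + #|miss e U y|) <= msum e U].
Proof.
move=> es ei lU xU yU zU exy exz eyz.
have neq a b : e a b -> a != b by apply: contraTneq => ->; rewrite ei.
have [xy xz yz] := And3 (neq _ _ exy) (neq _ _ exz) (neq _ _ eyz).
pose K := [set x; y; z].
have zK : z \in K by rewrite !inE eqxx orbT.
have KU : K \subset U by rewrite !subUset !sub1set xU yU zU.
have cK : clique e K.
  move=> a b; rewrite !inE => /orP[/orP[]|]/eqP-> /orP[/orP[]|]/eqP->;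
  by rewrite ?eqxx // es.
have KE : U :\: K = U :\ x :\ y :\ z.
  apply/setP=> t; rewrite !inE; case: (t \in U); rewrite ?andbF //.
  by case: (t == x); case: (t == y); case: (t == z).
have xD : y \in U :\ x by rewrite in_setD1 eq_sym xy.
have zD : z \in U :\ x :\ y by rewrite !in_setD1 !(eq_sym z) xz yz.
have cO : #|U :\: K| + 3 = #|U|.
  rewrite KE (cardsD1 x U) (cardsD1 y (U :\ x)) (cardsD1 z (U :\ x :\ y)).
  by rewrite xU xD zD addn3.
exists (contract e K z), (z |: (U :\: K)).
split; first exact: contraction_clique.
  by rewrite cardsU1 inE zK -cO addn3.
rewrite msum_contract // (msumD1 es xU) (msumD1 es xD) (msumD1 es zD) -KE.
rewrite !missD1_adj // 1?es //.
set X := [set u in _ | _].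
suff : #|X| <= #|miss e U z| by clear; lia.
apply: subset_leq_card; apply/subsetP=> t; rewrite inE mem_miss in_setD.
case/andP=> /andP[tK tU] /forall_inP/(_ z zK) -> ; rewrite tU andbT /=.
by apply: contraNneq tK => ->.
Qed.

Lemma linked_nbr e U v : linked e U -> v \in U -> 1 < #|U| ->
  exists2 u, u \in U & e v u.
Proof.
move=> lU vU U1; have [|||a [u [av uU eu]]] := lU [set v].
- by rewrite sub1set.
- by apply/set0Pn; exists v; rewrite set11.
- by apply: contraTneq U1 => <-; rewrite cards1.
exists u; first by move: uU; rewrite in_setD => /andP[].
by move: av eu; rewrite inE => /eqP->.
Qed.


(** * Splitting a neighborhood into two classes *)

Lemma rcol_leq k l e U : k <= l -> rcol k e U -> rcol l e U.
Proof.
by move=> kl [c [cs ck cr]]; exists c; split=> // u v; apply: leq_trans kl.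
Qed.

(** Outside [D] a vertex is put opposite to one of its neighbors; if that
    neighbor is not yet placed, the two are placed together. *)
Lemma opposite_extend e (N D : {set T}) (col : T -> bool) :
  symmetric e -> irreflexive e -> D \subset N ->
  {in N, forall u, exists2 w, w \in N & e u w} ->
  {in D, forall u, exists w, [/\ w \in D, e u w & col u != col w]} ->
  exists col' : T -> bool, {in D, col' =1 col} /\
    {in N, forall u, exists w, [/\ w \in N, e u w & col' u != col' w]}.
Proof.
move=> es ei; have [m] := ubnP #|N :\: D|.
elim: m D col => // m IH D col ltm DN hN hD.
have [ND|] := boolP (N \subset D).
  exists col; split=> // u /(subsetP ND)/hD[w [wD euw cuw]].
  by exists w; rewrite (subsetP DN).
case/subsetPn=> z zN zD; have [z' z'N ezz'] := hN z zN.
have zz' : z' != z by apply: contraTneq ezz' => ->; rewrite ei.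
have step (D' : {set T}) (col' : T -> bool) : D' \subset N -> D \subset D' -> z \in D' ->
    {in D, col' =1 col} ->
    {in D', forall u, exists w, [/\ w \in D', e u w & col' u != col' w]} ->
    exists col'' : T -> bool, {in D, col'' =1 col} /\
    {in N, forall u, exists w, [/\ w \in N, e u w & col'' u != col'' w]}.
  move=> D'N DD' zD' cc' h'; have [|col2 [c2 h2]] := IH D' col' _ D'N hN h'.
    rewrite -ltnS (leq_trans _ ltm) // ltnS; apply: proper_card.
    rewrite properE setDS //=; apply/subsetPn; exists z; first by rewrite inE zD.
    by rewrite inE zD'.
  exists col2; split=> // u uD; rewrite -cc' // c2 //.
  exact: (subsetP DD').
have zu u : u \in D -> u != z by apply: contraTneq => ->.
have [z'D|z'D] := boolP (z' \in D).
  apply: (step (z |: D) (fun u => if u == z then ~~ col z' else col u)).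
  - by rewrite subUset sub1set zN.
  - exact: subsetUr.
  - exact: setU11.
  - by move=> u /zu /negbTE->.
  move=> u; rewrite in_setU1 => /predU1P[->|uD].
    by exists z'; rewrite eqxx (negbTE zz') setU1r //; case: (col z').
  have [w [wD euw cuw]] := hD u uD; exists w.
  by rewrite (negbTE (zu u uD)) (negbTE (zu w wD)) setU1r.
have zu' u : u \in D -> u != z' by apply: contraTneq => ->.
apply: (step (z |: (z' |: D))
  (fun u => if u == z then true else if u == z' then false else col u)).
- by rewrite !subUset !sub1set zN z'N.
- by apply: subset_trans (subsetUr _ _); apply: subsetUr.
- exact: setU11.
- by move=> u uD; rewrite (negbTE (zu u uD)) (negbTE (zu' u uD)).
move=> u; rewrite !in_setU1 => /predU1P[->|/predU1P[->|uD]].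
- by exists z'; rewrite eqxx (negbTE zz') eqxx setU1r ?setU11.
- by exists z; rewrite eqxx (negbTE zz') eqxx setU11 es.
have [w [wD euw cuw]] := hD u uD; exists w.
rewrite (negbTE (zu u uD)) (negbTE (zu w wD)) (negbTE (zu' u uD)).
by rewrite (negbTE (zu' w wD)) !setU1r.
Qed.

(** Two edges, possibly sharing vertices, form a bipartite graph. *)
Lemma cut_two_pairs (a b a' b' : T) : a != b -> a' != b' ->
  exists col : T -> bool, col a != col b /\ col a' != col b'.
Proof.
move=> ab ab'.
have F (s t : T) : s != t -> ((s == t) = false) * ((t == s) = false).
  by move=> /negbTE st; rewrite [t == s]eq_sym st.
have [abF ab'F] := (F _ _ ab, F _ _ ab').
have [E|/F aa'] := eqVneq a a'.
  by exists (pred1 a); rewrite /= E !ab'F -E !abF !eqxx.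
have [E|/F ab2] := eqVneq a b'.
  by exists (pred1 a); rewrite /= E !ab'F -E !abF !eqxx.
have [E|/F ba'] := eqVneq b a'.
  by exists (pred1 b); rewrite /= E !ab'F -E !abF !eqxx.
have [E|/F bb'] := eqVneq b b'.
  by exists (pred1 b); rewrite /= E !ab'F -E !abF !eqxx.
by exists (fun u => (u == a) || (u == a')); rewrite !eqxx orbT !abF !ba' !ab2 !ab'F.
Qed.

Definition triangular e U :=
  {in U &, forall u w, e u w -> exists t, [/\ t \in U, e u t & e w t]}.

Lemma nbrs_no_isolated e U v : triangular e U -> v \in U ->
  {in nbr e U v, forall u, exists2 w, w \in nbr e U v & e u w}.
Proof.
move=> tri vU u; rewrite inE => /andP[uU evu].
by have [t [tU evt eut]] := tri v u vU uU evu; exists t; rewrite // inE tU.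
Qed.

(** As [x] is adjacent neither to [v] nor to anything that [v] misses, all its
    neighbors are neighbors of [v]; a triangle at [x] gives the edge. *)
Lemma miss_triangle e U v x : symmetric e -> irreflexive e -> linked e U ->
  triangular e U -> v \in U -> x \in miss e U v ->
  {in miss e U v, forall y, ~~ e x y} ->
  exists a b, [/\ a \in nbr e U v, b \in nbr e U v, e x a, e x b & e a b].
Proof.
move=> es ei lU tri vU xm indep.
have [xU xv evx] : [/\ x \in U, x != v & ~~ e v x].
  by move: xm; rewrite mem_miss => /and3P.
have toN a : a \in U -> e x a -> a \in nbr e U v.
  move=> aU exa; rewrite inE aU /=; apply: contraT => eva.
  suff /indep : a \in miss e U v by rewrite exa.
  rewrite mem_miss aU eva andbT; by apply: contraNneq evx => av; rewrite es -av.
have U1 : 1 < #|U| by rewrite (cardsD1 x) xU (cardsD1 v) in_setD1 eq_sym xv vU.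
have [a aU exa] := linked_nbr lU xU U1.
have [b [bU exb eab]] := tri x a xU aU exa.
by exists a, b; split=> //; apply: toN.
Qed.

(** The vertex missed by [v], if any, gets an entry into both classes around
    [v], so one color can serve its edges and those between neighbors of
    [v]. *)
Lemma rcol3_star e U v : symmetric e -> irreflexive e -> linked e U ->
  triangular e U -> v \in U -> #|miss e U v| <= 1 -> rcol 3 e U.
Proof.
move=> es ei lU tri vU m1; have hN := nbrs_no_isolated tri vU.
have m1E x y : x \in miss e U v -> y \in miss e U v -> x = y.
  by move=> xm ym; apply: (card_le1_eqP m1).
have indep x : x \in miss e U v -> {in miss e U v, forall y, ~~ e x y}.
  by move=> xm y ym; rewrite (m1E x y) // ei.
have [col [h1 h2]] : exists col : T -> bool,
    {in nbr e U v, forall u, exists w, [/\ w \in nbr e U v, e u w & col u != col w]} /\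
    {in miss e U v, forall x, exists a b,
      [/\ a \in nbr e U v, b \in nbr e U v, e x a, e x b & col a != col b]}.
  have [m0|[x xm]] := set_0Vmem (miss e U v).
    have [||u|col [_ h]] := @opposite_extend e (nbr e U v) set0 xpred0 es ei.
    - exact: sub0set.
    - exact: hN.
    - by rewrite inE.
    by exists col; split=> // x; rewrite m0 inE.
  have [a [b [aN bN xa xb ab]]] := miss_triangle es ei lU tri vU xm (indep x xm).
  have nab : b != a by apply: contraTneq ab => ->; rewrite ei.
  have [||u|col [hc h]] := @opposite_extend e (nbr e U v) [set a; b] (pred1 a) es ei.
  - by rewrite subUset !sub1set aN.
  - exact: hN.
  - rewrite !inE => /orP[]/eqP->; [exists b|exists a];
      by rewrite !inE ?eqxx ?orbT /= ?eqxx (negbTE nab) // es.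
  exists col; split=> // y ym; rewrite (m1E y x) //.
  by exists a, b; split=> //; rewrite !hc ?inE ?eqxx ?orbT //= eqxx (negbTE nab).
apply: (@rcol_star 3 e U v col (fun=> 0) 0) => //.
  move=> x xm; have [a [b [aN bN xa xb ab]]] := h2 x xm.
  by exists a; split=> //; right; exists b.
by move=> x y xm ym; rewrite (m1E x y) ?eqxx.
Qed.

(** Let [v] miss [x] and [y].  If they are adjacent they have a common neighbor
    around [v], and one entry each suffices because the color 3 of the edges
    between neighbors of [v] is not used on their own edges.  If not, each has
    entries into both classes, and their edges get the colors 0 and 3, so that
    they reach each other through [v] with all four colors. *)
Lemma rcol4_star e U v : symmetric e -> irreflexive e -> linked e U ->
  triangular e U -> v \in U -> #|miss e U v| <= 2 -> rcol 4 e U.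
Proof.
move=> es ei lU tri vU; rewrite leq_eqVlt => /orP[/cards2P[x [y [xy mE]]]|m1]; last first.
  by apply: (@rcol_leq 3) => //; apply: (@rcol3_star e U v).
have hN := nbrs_no_isolated tri vU.
have xm : x \in miss e U v by rewrite mE !inE eqxx.
have ym : y \in miss e U v by rewrite mE !inE eqxx orbT.
have [xU xv evx] : [/\ x \in U, x != v & ~~ e v x].
  by move: xm; rewrite mem_miss => /and3P.
have yU : y \in U by move: ym; rewrite mem_miss => /and3P[].
have [exy|exy] := boolP (e x y).
  have [a [aU exa eya]] := tri x y xU yU exy.
  have aN : a \in nbr e U v.
    rewrite inE aU /=; apply: contraT => eva.
    have : a \in miss e U v.
      rewrite mem_miss aU eva andbT /=; apply: contraNneq evx => av.
      by rewrite -av es.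
    rewrite mE !inE => /orP[]/eqP aE; first by rewrite aE ei in exa.
    by rewrite aE ei in eya.
  have [||u|col [_ h]] := @opposite_extend e (nbr e U v) set0 xpred0 es ei.
  - exact: sub0set.
  - exact: hN.
  - by rewrite inE.
  apply: (@rcol_star 4 e U v col (fun=> 0) 3) => //.
    by move=> z; rewrite mE !inE => /orP[]/eqP->; exists a; split=> //; left.
  move=> z t; rewrite mE !inE => /orP[]/eqP-> /orP[]/eqP->; rewrite ?eqxx // => _.
    by left.
  by left; rewrite es.
have indep z : z \in miss e U v -> {in miss e U v, forall t, ~~ e z t}.
  rewrite mE !inE => /orP[]/eqP-> t; rewrite !inE => /orP[]/eqP->;
  by rewrite ?ei // es.
have [a [b [aN bN xa xb ab]]] := miss_triangle es ei lU tri vU xm (indep x xm).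
have [a' [b' [aN' bN' ya yb ab']]] := miss_triangle es ei lU tri vU ym (indep y ym).
have neq s t : e s t -> s != t by apply: contraTneq => ->; rewrite ei.
have [col0 [cab cab']] := cut_two_pairs (neq _ _ ab) (neq _ _ ab').
pose D := [set a; b; a'; b'].
have [||u|col [hc h]] := @opposite_extend e (nbr e U v) D col0 es ei.
- by rewrite !subUset !sub1set aN bN aN' bN'.
- exact: hN.
- rewrite !inE => /orP[/orP[/orP[]|]|]/eqP->; [exists b|exists a|exists b'|exists a'];
    by rewrite !inE ?eqxx ?orbT //; split=> //; rewrite 1?es // eq_sym.
have hS z : z \in miss e U v -> exists s t, [/\ s \in nbr e U v, t \in nbr e U v,
    e z s, e z t & col s != col t].
  rewrite mE !inE => /orP[]/eqP->; [exists a, b|exists a', b'];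
  by split=> //; rewrite !hc // !inE eqxx ?orbT.
apply: (@rcol_star 4 e U v col (fun u => if u == x then 0 else 3) 0) => //.
- by move=> z; case: ifP.
- by move=> z; case: ifP.
- move=> z zm; have [s [t [sN tN zs zt st]]] := hS z zm.
  by exists s; split=> //; right; exists t.
move=> z t zm tm zt; right; split.
  have yx : (y == x) = false by rewrite eq_sym (negbTE xy).
  by move: zm tm zt; rewrite mE !inE => /orP[]/eqP-> /orP[]/eqP->;
    rewrite ?eqxx ?yx.
have [s1 [t1 [s1N t1N zs1 zt1 st1]]] := hS z zm.
have [s2 [t2 [s2N t2N zs2 zt2 st2]]] := hS t tm.
have [E|E] := eqVneq (col s1) (col s2); last by exists s1, s2.
by exists s1, t2; rewrite E.
Qed.

(** * Common neighbors serving a deleted vertex *)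

Definition spread (R : T -> {set T}) d (l : seq T) (f : T -> T) :=
  {in l, forall y, f y \in R y} /\ forall w, count (fun y => f y == w) l <= d.

(** Fewer than [2 * d] choices have been made, so at most one of two candidates
    for [y] has already been chosen [d] times. *)
Lemma spread_cons R d l f y : spread R d l f -> y \notin l -> 1 < #|R y| ->
  size l < 2 * d -> exists g, spread R d (y :: l) g.
Proof.
move=> [fR fd] yl /card_gt1P[a [b [aR bR ab]]] sl.
have [w wR wd] : exists2 w, w \in R y & count (fun y => f y == w) l < d.
  have [ad|ad] := ltnP (count (fun y => f y == a) l) d; first by exists a.
  exists b => //; rewrite -(ltn_add2l d) addnn -mul2n (leq_ltn_trans _ sl) //.
  apply: leq_trans (leq_add ad (leqnn _)) _; rewrite -count_predUI.
  rewrite (@eq_count _ (predI _ _) pred0) ?count_pred0 ?addn0 ?count_size //.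
  by move=> x /=; case: eqP => //= ->; apply/negbTE.
exists (fun x => if x == y then w else f x); split=> [x|v].
  by rewrite in_cons; case: (eqVneq x y) => [->//|_ /=]; apply: fR.
have fE : {in l, (fun x => (if x == y then w else f x) == v) =1 (fun x => f x == v)}.
  by move=> x xl /=; rewrite ifN //; by apply: contraNneq yl => <-.
rewrite /= eqxx (eq_in_count fE); case: eqP => [<-|_] //=.
by rewrite add0n.
Qed.

(** The at most [d] elements with a single candidate choose first, without
    restriction; the others follow one at a time. *)
Lemma spread_ex (R : T -> {set T}) d (l : seq T) : uniq l -> size l <= 2 * d ->
  {in l, forall y, 0 < #|R y|} -> count (fun y => #|R y| <= 1) l <= d ->
  exists f, spread R d l f.
Proof.
pose few y := #|R y| <= 1; move=> ul sl Rl cl.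
(* The default [y] is never taken, since the sets [R y] are nonempty. *)
pose f0 y := odflt y [pick w in R y].
have f0P y : 0 < #|R y| -> f0 y \in R y.
  by rewrite /f0; case: pickP => //= R0; rewrite eq_card0.
pose l1 := filter few l; pose l2 := filter (predC few) l.
have pl : perm_eq (l2 ++ l1) l.
  by rewrite perm_catC; apply/permPl/perm_filterC.
suff [f [f1 f2]] : exists f, spread R d (l2 ++ l1) f.
  exists f; split=> [y yl|w]; first by apply: f1; rewrite (perm_mem pl).
  by rewrite -(permP pl).
have: size (l2 ++ l1) <= 2 * d by rewrite (perm_size pl).
have: uniq (l2 ++ l1) by rewrite (perm_uniq pl).
have: all (predC few) l2 by apply: filter_all.
elim: l2 {pl} => [_ _ _|y l2 IH /=].
  exists f0; split=> [y|w] /=.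
    by rewrite mem_filter => /andP[_ yl]; apply: f0P; apply: Rl.
  apply: leq_trans (count_size _ _) _; by rewrite size_filter.
case/andP=> fy fl2 /andP[yl ul2] sz; have [f hf] := IH fl2 ul2 (ltnW sz).
by apply: spread_cons hf yl _ sz; rewrite ltnNge.
Qed.

Definition via e U x y := [set w in U | e x w && e w y].

Lemma card_count (D : {set T}) (p : pred T) :
  #|[set y in D | p y]| = count p (enum D).
Proof.
rewrite -size_filter cardE; apply: perm_size; apply: uniq_perm.
- exact: enum_uniq.
- by apply: filter_uniq; apply: enum_uniq.
by move=> y; rewrite [RHS]mem_filter !mem_enum inE andbC.
Qed.

Lemma rcol_removal k e U x : symmetric e -> irreflexive e -> x \in U ->
  #|miss e U x| <= 2 * k -> {in miss e U x, forall y, 0 < #|via e U x y|} ->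
  #|[set y in miss e U x | #|via e U x y| <= 1]| <= k ->
  rcol k.+1 e (U :\ x) -> rcol k.+1 e U.
Proof.
move=> es ei xU mk h1 h2 r.
have [||||f [f1 f2]] := @spread_ex (via e U x) k (enum (miss e U x)).
- exact: enum_uniq.
- by rewrite -cardE.
- by move=> y ye; apply: h1; move: ye; rewrite mem_enum.
- by rewrite -card_count.
apply: (rcol_add (f := f) es xU _ ei _ r).
  move=> y ym; have ye : y \in enum (miss e U x) by rewrite mem_enum.
  by have := f1 y ye; rewrite inE => /and3P[-> -> ->].
by move=> w; rewrite ltnS card_count.
Qed.

(** A vertex [w] serves only neighbors of its own other than [x], so a bound on
    all degrees makes every choice of common neighbors suitable. *)
Lemma rcol_removal_any k e U x : symmetric e -> irreflexive e -> x \in U ->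
  {in miss e U x, forall y, 0 < #|via e U x y|} ->
  {in U, forall w, #|nbr e U w| <= k.+1} ->
  rcol k.+1 e (U :\ x) -> rcol k.+1 e U.
Proof.
move=> es ei xU h1 hk r; pose f y := odflt y [pick w in via e U x y].
have fP y : y \in miss e U x -> [/\ f y \in U, e x (f y) & e (f y) y].
  move/h1; rewrite /f; case: pickP => [w|R0]; last by rewrite eq_card0.
  by rewrite inE => /and3P[].
apply: (rcol_add (f := f) es xU _ ei _ r).
  by move=> y /fP[-> -> ->].
move=> w; set F := [set y in _ | _]; have [->|[y]] := set_0Vmem F.
  by rewrite cards0.
rewrite inE => /andP[/fP[fU exf _] /eqP fw]; rewrite fw in fU exf.
have xN : x \in nbr e U w by rewrite inE xU es.
rewrite ltnS; have := hk w fU; rewrite (cardsD1 x) xN ltnS; apply: leq_trans.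
apply: subset_leq_card; apply/subsetP=> z; rewrite inE => /andP[zm /eqP fz].
have [_ _ ez] := fP z zm; rewrite fz in ez.
by move: zm; rewrite mem_miss !inE ez => /and3P[-> -> _].
Qed.

(** A neighbor of [y] is either a common neighbor of [x] and [y] or, like [y],
    missed by [x]. *)
Lemma nbr_via e U x y : symmetric e -> x \in U -> y \in miss e U x ->
  #|nbr e U y| <= #|via e U x y| + #|nbr e (miss e U x) y|.
Proof.
move=> es xU ym; apply: leq_trans (leq_card_setU _ _); apply: subset_leq_card.
apply/subsetP=> w; rewrite !inE => /andP[wU eyw].
rewrite wU (es w y) eyw /= !andbT; case: (boolP (e x w)) => //= _; rewrite andbT.
by apply: contraTneq eyw => ->; move: ym; rewrite mem_miss es => /and3P[].
Qed.

Lemma card_via e U x y : symmetric e -> irreflexive e -> x \in U ->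
  y \in miss e U x -> #|nbr e U y| + 1 <= #|via e U x y| + #|miss e U x|.
Proof.
move=> es ei xU ym; rewrite (cardsD1 y (miss e U x)) ym addnCA addnC leq_add2l.
apply: leq_trans (nbr_via es xU ym) _; rewrite leq_add2l; apply: subset_leq_card.
apply/subsetP=> w; rewrite inE in_setD1 => /andP[-> eyw]; rewrite andbT.
by apply: contraTneq eyw => ->; rewrite ei.
Qed.

(** * Rigid graphs *)

(** The slack [r] will be 2 for three colors and 1 for four, the largest values
    for which contracting an offending triangle leaves few enough missing pairs
    for one color less. *)
Definition rigid r e U := triangular e U /\
  {in U &, forall y z, e y z -> #|miss e U y| + #|miss e U z| + r <= #|U|}.

(** An edge violating the first half of rigidity is contracted, one violating
    the second half lies in a triangle that is contracted. *)
Lemma contractible_or_rigid r e U : symmetric e -> irreflexive e ->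
  linked e U -> rigid r e U \/
  exists e' U', contraction e U e' U' /\
    (#|U| = #|U'|.+1 /\ msum e' U' + 2 * (#|U| - 2) <= msum e U \/
     #|U| = #|U'|.+2 /\ msum e' U' + 2 * #|U|.+1 <= msum e U + 2 * r).
Proof.
move=> es ei lU.
have [tri|] := boolP [forall y in U, forall z in U, e y z ==>
    [exists t in U, e y t && e z t]]; last first.
  case/forall_inPn=> y yU /forall_inPn[z zU]; rewrite negb_imply.
  case/andP=> eyz /exists_inPn no; right.
  have [e' [U' [h cU cM]]] := contract_edge es ei lU yU zU eyz no.
  by exists e', U'; split=> //; left.
have {}tri : triangular e U.
  move=> y z yU zU eyz; have /forall_inP/(_ z zU) := forall_inP tri y yU.
  by rewrite eyz => /exists_inP[t tU /andP[? ?]]; exists t.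
have [light|] := boolP [forall y in U, forall z in U, e y z ==>
    (#|miss e U y| + #|miss e U z| + r <= #|U|)]; last first.
  case/forall_inPn=> y yU /forall_inPn[z zU]; rewrite negb_imply -ltnNge.
  case/andP=> eyz hyz; have [t [tU eyt ezt]] := tri y z yU zU eyz; right.
  have [e' [U' [h cU cM]]] :=
    contract_triangle es ei lU yU zU tU eyz eyt ezt.
  by exists e', U'; split=> //; right; split=> //; lia.
left; split=> // y z yU zU eyz.
by have /forall_inP/(_ z zU) := forall_inP light y yU; rewrite eyz.
Qed.

(** Rigidity applied to an edge at [u]: the other end misses at least [s]
    vertices, which bounds the missing degree of [u]. *)
Lemma card_nbr_ge e U r s : symmetric e -> irreflexive e -> linked e U ->
  rigid r e U -> 1 < #|U| -> {in U, forall u, s <= #|miss e U u|} ->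
  {in U, forall u, s + r <= #|nbr e U u| + 1}.
Proof.
move=> es ei lU [_ hr] U1 hs u uU; have [w wU euw] := linked_nbr lU uU U1.
have := card_nbr_miss ei uU; have := hr u w uU wU euw; have := hs w wU; lia.
Qed.

(** * Cuts *)

Definition separated e U A := {in A & U :\: A, forall u v, ~~ e u v}.

Lemma linked_uncut e U :
  (forall A, A \subset U -> A != set0 -> U :\: A != set0 -> ~ separated e U A) ->
  linked e U.
Proof.
move=> h A AU A0 AN.
have [/exists_inP[u uA /exists_inP[v vB euv]]|no] :=
  boolP [exists u in A, [exists v in U :\: A, e u v]]; first by exists u, v.
case: (h A AU A0); last first.
  move=> u v uA vB; apply: contraNN no => euv.
  by apply/exists_inP; exists u => //; apply/exists_inP; exists v.
by rewrite setD_eq0; apply: contraNN AN => UA; rewrite eqEsubset AU.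
Qed.

Lemma separatedC e U A : symmetric e -> A \subset U -> separated e U A ->
  separated e U (U :\: A).
Proof.
by move=> es AU sA u v uB vA; rewrite es; apply: sA => //;
  move: vA; rewrite setDDr setDv set0U (setIidPr AU).
Qed.

Lemma separated_miss e U A p : A \subset U -> separated e U A -> p \in A ->
  U :\: A \subset miss e U p.
Proof.
move=> AU sA pA; apply/subsetP=> w wB; rewrite mem_miss (sA p w pA wB) andbT.
move: wB; rewrite in_setD => /andP[wA ->] /=.
by apply: contraNneq wA => ->.
Qed.

Lemma separated_msum e U A : symmetric e -> A \subset U -> separated e U A ->
  2 * (#|A| * #|U :\: A|) <= msum e U.
Proof.
move=> es AU sA; rewrite /msum (big_setID A) /= (setIidPr AU) mul2n -addnn.
apply: leq_add.
  rewrite mulnC; apply: leq_sum_miss => // p pA.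
  by apply: subset_leq_card; apply: separated_miss.
apply: leq_sum_miss (subsetDl _ _) _ => p pB; apply: subset_leq_card.
have := separated_miss (subsetDl U A) (separatedC es AU sA) pB.
by rewrite setDDr setDv set0U (setIidPr AU).
Qed.

Lemma separated_nbr e U A x p : irreflexive e -> separated e (U :\ x) A ->
  p \in A -> nbr e U p \subset x |: (A :\ p).
Proof.
move=> ei sA pA; apply/subsetP=> w; rewrite inE => /andP[wU epw].
rewrite in_setU1 in_setD1; have [//|wx] := eqVneq w x.
have -> /= : w != p by apply: contraTneq epw => ->; rewrite ei.
apply: contraLR epw => wA; apply: sA => //.
by rewrite in_setD wA in_setD1 wx.
Qed.

Lemma separated_card_nbr e U A x p : irreflexive e -> separated e (U :\ x) A ->
  p \in A -> #|nbr e U p| <= #|A|.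
Proof.
move=> ei sA pA; have := subset_leq_card (separated_nbr ei sA pA).
move=> le; apply: leq_trans le _; rewrite cardsU1 (cardsD1 p A) pA.
by rewrite leq_add2r leq_b1.
Qed.

Lemma card_cut U A x : x \in U -> A \subset U :\ x ->
  #|A| + #|(U :\ x) :\: A| + 1 = #|U|.
Proof.
by move=> xU AU; rewrite (cardsD1 x U) xU -(cardsID A (U :\ x)) (setIidPr AU) addnC.
Qed.

Lemma min_miss e U : U != set0 ->
  exists2 x, x \in U & {in U, forall u, #|miss e U x| <= #|miss e U u|}.
Proof.
case/set0Pn=> i iU; have [x xU h] := arg_minnP (fun u => #|miss e U u|) iU.
by exists x.
Qed.

(** * Three colors *)

(** Rigidity makes every degree at least [s + 1], where [s] is the least
    missing degree.  If [s >= 2], then each vertex missed by [x] has at least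
    two common neighbors with [x], because at most [s - 1] of its neighbors are
    missed by [x]; and the two sides of a cut at [x] would have more than [s]
    vertices each, hence too many missing pairs between them. *)
Lemma rcol3_dense e U : symmetric e -> irreflexive e -> linked e U ->
  msum e U + 10 <= 4 * #|U| -> rcol 3 e U.
Proof.
move=> es ei; have [m] := ubnP #|U|; elim: m U => // m IH U ltm lU hM.
have U1 : 1 < #|U| by lia.
have [rig|[e' [U' [[es' ei' lU' h] cM]]]] :=
  contractible_or_rigid 2 es ei lU; last by apply: h; apply: rcol2 => //; lia.
have [tri light] := rig.
have [|x xU minx] := @min_miss e U; first by rewrite -card_gt0; lia.
have [s1|s2] := leqP #|miss e U x| 1; first exact: rcol3_star s1.
set s := #|miss e U x| in minx s2.
have sU : s * #|U| <= msum e U by apply: leq_sum_miss.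
have deg := card_nbr_ge es ei lU rig U1 minx.
have via2 : {in miss e U x, forall y, 1 < #|via e U x y|}.
  move=> y ym; have := card_via es ei xU ym; rewrite -/s.
  have /deg : y \in U by move: ym; rewrite mem_miss => /andP[].
  lia.
apply: (@rcol_removal 2 e U x) => //.
- by rewrite -/s; nia.
- by move=> y ym; apply: ltnW; apply: via2.
- rewrite (_ : [set y in _ | _] = set0) ?cards0 //; apply/setP=> y.
  rewrite inE in_set0; apply/negP=> /andP[/via2]; lia.
have MU := msumD1 es xU; rewrite -/s in MU.
have cU : #|U| = (#|U :\ x|).+1 by rewrite (cardsD1 x) xU.
apply: IH; [by lia| |by lia].
apply: linked_uncut => A AU /set0Pn[p pA] /set0Pn[q qB] sA.
have sB := separatedC es AU sA.
have := separated_msum es AU sA; have := card_cut xU AU.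
have := separated_card_nbr ei sA pA; have := separated_card_nbr ei sB qB.
have pU : p \in U by have := subsetP AU p pA; rewrite in_setD1 => /andP[].
have qU : q \in U by move: qB; rewrite !in_setD => /and3P[].
have := deg p pU; have := deg q qU.
set a := #|A|; set b := #|_ :\: A|; nia.
Qed.

(** * Four colors *)

(** Here rigidity only gives degrees at least [s], the least missing degree,
    and two extremal situations need an argument of their own.

    A cut at [x] with sides of sizes [a] and [b] forces [s = 3] and [a = 3] or
    [b = 3].  A side of size 3 is then a triangle joined completely to [x], and
    rigidity of one of its edges gives the other side size 3 as well.  So [x]
    misses nothing, which contradicts [s = 3].

    The choice of common neighbors fails only if at least four vertices missed
    by [x] have just one common neighbor with [x].  Their degree is at least
    [s], so any two of them are adjacent, and rigidity of such an edge gives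
    [n <= 2s + 1], hence [s = 4] and [n = 9].  All degrees are then at most 4
    and any choice of common neighbors is suitable. *)
Lemma rcol4_dense e U : symmetric e -> irreflexive e -> linked e U ->
  msum e U + 18 <= 6 * #|U| -> rcol 4 e U.
Proof.
move=> es ei; have [m] := ubnP #|U|; elim: m U => // m IH U ltm lU hM.
have U1 : 1 < #|U| by lia.
have [rig|[e' [U' [[es' ei' lU' h] cM]]]] :=
  contractible_or_rigid 1 es ei lU; last by apply: h; apply: rcol3_dense => //; lia.
have [tri light] := rig.
have [|x xU minx] := @min_miss e U; first by rewrite -card_gt0; lia.
have [s2|s3] := leqP #|miss e U x| 2; first exact: rcol4_star s2.
set s := #|miss e U x| in minx s3.
have sU : s * #|U| <= msum e U by apply: leq_sum_miss.
have deg := card_nbr_ge es ei lU rig U1 minx.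
have MU := msumD1 es xU; rewrite -/s in MU.
have cU : #|U| = (#|U :\ x|).+1 by rewrite (cardsD1 x) xU.
have rx : rcol 4 e (U :\ x).
  apply: IH; [by lia| |by lia].
  apply: linked_uncut => A AU A0 B0 sA.
  have sB := separatedC es AU sA.
  have degA (C : {set T}) p : C \subset U :\ x -> separated e (U :\ x) C -> p \in C ->
      s <= #|C|.
    move=> CU sC pC; have := separated_card_nbr ei sC pC.
    have pU : p \in U by have := subsetP CU p pC; rewrite in_setD1 => /andP[].
    have := deg p pU; lia.
  have three (C : {set T}) : C \subset U :\ x -> separated e (U :\ x) C -> #|C| = 3 ->
      s = 3 -> 3 <= #|(U :\ x) :\: C| ->
      #|(U :\ x) :\: C| = 3 /\ {in C, forall p, e p x}.
    move=> CU sC C3 s3' B3.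
    have CU' p : p \in C -> p \in U.
      by move=> /(subsetP CU); rewrite in_setD1 => /andP[].
    have full p : p \in C -> nbr e U p = x |: (C :\ p).
      move=> pC; apply/eqP; rewrite eqEcard separated_nbr //=.
      have := deg p (CU' p pC); have := cardsU1 x (C :\ p).
      by move: C3; rewrite (cardsD1 p C) pC; lia.
    split; last first.
      move=> p pC; have : x \in nbr e U p by rewrite full ?setU11.
      by rewrite inE => /andP[].
    have /card_gt1P[p [q [pC qC pq]]] : 1 < #|C| by rewrite C3.
    have epq : e p q.
      have : q \in nbr e U p by rewrite full // !inE qC (eq_sym q p) pq orbT.
      by rewrite inE => /andP[].
    have big r : r \in C -> #|(U :\ x) :\: C| <= #|miss e U r|.
      move=> rC; apply: leq_trans (subset_leq_card (separated_miss CU sC rC)) _.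
      by rewrite missD1 subset_leq_card ?subD1set.
    have := light p q (CU' p pC) (CU' q qC) epq.
    have := big p pC; have := big q qC; have := card_cut xU CU.
    move: C3 B3; clear; lia.
  have /set0Pn[p pA] := A0; have /set0Pn[q qB] := B0.
  have := separated_msum es AU sA; have := card_cut xU AU.
  have := degA _ _ AU sA pA; have BU := subsetDl (U :\ x) A.
  have := degA _ _ BU sB qB.
  have BB : (U :\ x) :\: ((U :\ x) :\: A) = A.
    by rewrite setDDr setDv set0U (setIidPr AU).
  move=> sb sa cc hh.
  have [s3' ab3] : s = 3 /\ (#|A| = 3 \/ #|(U :\ x) :\: A| = 3).
    by move: sb sa cc hh; set a := #|A|; set b := #|_ :\: A| => *; split; nia.
  have [tA tB] : {in A, forall p, e p x} /\ {in (U :\ x) :\: A, forall p, e p x}.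
    case: ab3 => c3.
      have [|b3 tA] := three A AU sA c3 s3'; first by lia.
      by have [|_ tB] := three _ BU sB b3 s3'; rewrite ?BB ?c3.
    have [|] := three _ BU sB c3 s3'; rewrite BB; first by lia.
    by move=> a3 tB; have [|_ tA] := three _ AU sA a3 s3'; rewrite ?c3.
  suff : s = 0 by lia.
  apply/eqP; rewrite /s cards_eq0; apply/eqP/setP=> w; rewrite mem_miss in_set0.
  case: (boolP (w \in U)) => //= wU; case: eqP => //= /eqP wx.
  rewrite es; case: (boolP (w \in A)) => wA; first by rewrite tA.
  by rewrite tB // in_setD wA in_setD1 wx.
have via1 : {in miss e U x, forall y, 0 < #|via e U x y|}.
  move=> y ym; have := card_via es ei xU ym; rewrite -/s.
  have /deg : y \in U by move: ym; rewrite mem_miss => /andP[].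
  lia.
set Z := [set y in miss e U x | #|via e U x y| <= 1].
have [Z3|Z4] := leqP #|Z| 3.
  by apply: (@rcol_removal 3 e U x) => //; rewrite -/s; nia.
have ZE y : y \in Z -> [/\ y \in U, y \in miss e U x & #|via e U x y| <= 1].
  by rewrite inE => /andP[ym ->]; split=> //; move: ym; rewrite mem_miss => /andP[].
have sZ : #|Z| <= s by apply: subset_leq_card; apply/subsetP=> y /ZE[].
have /card_gt1P[y [z [yZ zZ yz]]] : 1 < #|Z| by lia.
have [[yU ym y1] [zU zm z1]] := (ZE y yZ, ZE z zZ).
have eyz : e y z.
  apply: contraTT y1 => eyz; rewrite -ltnNge.
  have := nbr_via es xU ym; have := deg y yU.
  have : nbr e (miss e U x) y \subset miss e U x :\ y :\ z.
    apply/subsetP=> w; rewrite inE !in_setD1 => /andP[-> eyw]; rewrite andbT.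
    by apply/andP; split; [apply: contraNneq eyz => <-|
      apply: contraTneq eyw => ->; rewrite ei].
  move/subset_leq_card; have: s = #|miss e U x :\ y :\ z| + 2.
    rewrite /s (cardsD1 y) ym (cardsD1 z) in_setD1 zm eq_sym yz; lia.
  lia.
have := card_via es ei xU ym; have := card_via es ei xU zm; rewrite -/s.
have := light y z yU zU eyz; have := card_nbr_miss ei yU; have := card_nbr_miss ei zU.
move=> cz cy hyz vz vy.
have n9 : #|U| <= 2 * s + 1.
  by move: hyz vz vy cz cy y1 z1; clear; lia.
have s4 : s = 4 by move: n9 s3 sU hM sZ Z4; clear; nia.
apply: (@rcol_removal_any 3 e U x) => // w wU.
have := card_nbr_miss ei wU; have := minx w wU; move: n9 s4; clear; lia.
Qed.

End Walks.

(** * From colored walks to rainbow connection *)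

Lemma linked_connected (G : sgraph) : connected G -> linked (@adj G) setT.
Proof.
move=> cG; apply: linked_uncut => A _ /set0Pn[a aA] /set0Pn[b bA] sA.
have cl : closed (@adj G) (mem A).
  move=> u v euv /=; apply/idP/idP => hA; apply: contraTT euv => hN.
    by apply: sA; rewrite // !inE hN.
  by rewrite adj_sym; apply: sA; rewrite // !inE hN.
by move: bA; rewrite inE -(closed_connect cl (cG a b)) aA.
Qed.

(** The ordered pairs of vertices are equal, adjacent or missing, and every edge
    comes from at least two adjacent ordered pairs. *)
Lemma edges_msum (G : sgraph) :
  2 * #|edges G| + msum (@adj G) setT + #|G| <= #|G| * #|G|.
Proof.
have ei := @adj_irr G; have es := @adj_sym G.
have -> : #|G| * #|G| = \sum_(u in [set: G])
    (#|nbr (@adj G) setT u| + #|miss (@adj G) setT u| + 1).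
  by rewrite (eq_bigr (fun=> #|G|)) ?sum_nat_const ?cardsT // => u _;
    rewrite card_nbr_miss ?cardsT ?inE.
rewrite !big_split /= sum1_card cardsT !leq_add2r.
under eq_bigr => u _ do rewrite -sum1_card.
rewrite pair_big_dep /= (partition_big (fun p => [set p.1; p.2]) (mem (edges G))) /=.
  rewrite mulnC -sum_nat_const; apply: leq_sum => A /imset2P[x y _].
  rewrite inE => /andP[_ exy] ->.
  have xy : x != y by apply: contraTneq exy => ->; rewrite ei.
  rewrite sum1_card; apply: (@leq_trans #|[set (x, y); (y, x)]|).
    by rewrite cards2 xpair_eqE negb_and xy.
  apply: subset_leq_card; apply/subsetP=> p; rewrite !inE => /orP[]/eqP-> /=.
    by rewrite unfold_in /= !inE exy eqxx.
  by rewrite unfold_in /= !inE es exy setUC eqxx.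
move=> [x y] /=; rewrite !inE /= => exy.
by apply/imset2P; exists x y; rewrite ?inE.
Qed.

Lemma rainbow_colorable_rcol k (G : sgraph) : 0 < k ->
  rcol k (@adj G) setT -> rainbow_colorable G k.
Proof.
move=> k0 [c [cs ck cr]].
(* The two orders of an edge give the same color since [c] is symmetric; the
   value 0 is for sets with more than two elements and the empty set. *)
pose d (A : {set G}) :=
  if [pick p : G * G | A == [set p.1; p.2]] is Some p then c p.1 p.2 else 0.
have dE u v : d [set u; v] = c u v.
  rewrite /d; case: pickP => [[a b] /= /eqP E|/(_ (u, v))]; last by rewrite eqxx.
  have /set2P ha : a \in [set u; v] by rewrite E set21.
  have /set2P hb : b \in [set u; v] by rewrite E set22.
  have /set2P hu : u \in [set a; b] by rewrite -E set21.
  have /set2P hv : v \in [set a; b] by rewrite -E set22.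
  case: ha hb hu hv => -> [] -> // hu hv; first by case: hv => ->.
  by case: hu => ->.
exists d; split=> [A _|x y]; first by rewrite /d; case: pickP.
have [||s [us ws]] := cr x y; rewrite ?inE //.
have [p [pp up _ lp sp]] := walk_path ws; exists p; split=> //.
rewrite (_ : path_colors d x p = pairmap c x p); first exact: subseq_uniq sp us.
rewrite /path_colors; elim: p x {pp up lp sp ws} => //= z p IH x.
by rewrite dE IH.
Qed.

Theorem theorem2p4 (G : sgraph) (conG : connected G) (n : nat)
    (order_G : #|G| = n) (n_ge5 : 5 <= n)
    (many_edges : 'C(n - 3, 2) + 3 <= #|edges G|) :
  rc conG <= 4.
Proof.
have few : msum (@adj G) setT + 18 <= 6 * #|[set: G]|.
  rewrite cardsT order_G; have := edges_msum G; rewrite order_G.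
  have [m nE] : exists m, n = m + 5 by exists (n - 5); rewrite subnK.
  move: many_edges; rewrite nE (_ : m + 5 - 3 = m.+2); last by lia.
  have := mul_bin_diag m.+2 1; rewrite bin1 /=; nia.
rewrite /rc; case: ex_minnP => k _; apply; apply/boolp.asboolP.
apply: rainbow_colorable_rcol => //.
apply: rcol4_dense few; [exact: adj_sym|exact: adj_irr|exact: linked_connected].
Qed.
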